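(* The net-degree sequence of a simple digraph $D$ is uniquely realizable if and only if $D$ does not contain any of the following four digraphs on three nodes as an induced subgraph: (D1) three nodes with no arcs; (D2) three nodes $u,v,w$ with the single arc $(u,w)$; (D3) the directed triangle, with arcs $(u,v),(v,w),(w,u)$; (D4) the directed path with exactly the two arcs $(u,v),(v,w)$ (and $u,w$ non-adjacent).
   Context: A (simple) digraph $D=(V,A)$ is a finite simple undirected graph together with an orientation of each edge; so $A\subseteq V\times V$ contains no $(v,v)$, and at most one of $(u,v),(v,u)$. Its net-degree sequence is $\mathbf d(D)\in\mathbb Z^V$ with $\mathbf d(D)_v=|\{u:(u,v)\in A\}|-|\{u:(v,u)\in A\}|$. The net-degree sequence $\mathbf d$ of $D=(V,A)$ is uniquely realizable if $D$ is the only simple digraph on the (labelled) node set $V$ with net-degree sequence $\mathbf d$. ''Contains as an induced subgraph'' means that the subdigraph induced on some three-element node subset is isomorphic to the given digraph. *)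

(* Defs.v *)
From mathcomp Require Import all_boot all_order all_algebra.

Set Implicit Arguments.
Unset Strict Implicit.
Unset Printing Implicit Defensive.

Import GRing.Theory.

Local Open Scope ring_scope.

(* A digraph on the labelled node set V is given by its set of arcs
   A : {set V * V}, (u, v) being the arc from u to v. *)

Definition simple_digraph (V : finType) (A : {set V * V}) : Prop :=
  (forall v : V, (v, v) \notin A) /\
  (forall u v : V, ~~ (((u, v) \in A) && ((v, u) \in A))).

(* Sign convention: in-degree minus out-degree. *)
Definition net_degree (V : finType) (A : {set V * V}) : {ffun V -> int} :=
  [ffun v => (#|[set u | (u, v) \in A]|)%:Z - (#|[set u | (v, u) \in A]|)%:Z].

(* The realizations are compared as labelled digraphs, not up to isomorphism. *)
Definition net_degree_uniquely_realizable (V : finType) (A : {set V * V}) :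
    Prop :=
  forall B : {set V * V},
    simple_digraph B -> net_degree B = net_degree A -> B = A.

Definition induced_subdigraph (V : finType) (A : {set V * V}) (S : {set V}) :
    {set {x : V | x \in S} * {x : V | x \in S}} :=
  [set a | (val a.1, val a.2) \in A].

Definition digraph_isomorphic (V W : finType)
    (A : {set V * V}) (B : {set W * W}) : Prop :=
  exists f : V -> W,
    bijective f /\ forall x y : V, ((x, y) \in A) = ((f x, f y) \in B).

(* The isomorphism forces #|S| = #|W|. *)
Definition contains_induced (V W : finType)
    (A : {set V * V}) (H : {set W * W}) : Prop :=
  exists S : {set V}, digraph_isomorphic (induced_subdigraph A S) H.

Definition node_u : 'I_3 := @Ordinal 3 0 isT.
Definition node_v : 'I_3 := @Ordinal 3 1 isT.
Definition node_w : 'I_3 := @Ordinal 3 2 isT.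

Definition empty3 : {set 'I_3 * 'I_3} := set0.

Definition single_arc3 : {set 'I_3 * 'I_3} := [set (node_u, node_w)].

Definition directed_triangle : {set 'I_3 * 'I_3} :=
  [set (node_u, node_v); (node_v, node_w); (node_w, node_u)].

Definition directed_path3 : {set 'I_3 * 'I_3} :=
  [set (node_u, node_v); (node_v, node_w)].

(* Main.v *)
Require Import Defs.
From mathcomp Require Import all_boot all_order all_algebra.
From mathcomp Require Import zify.

(** Give every ordered pair the value 1, -1 or 0 according to whether it is an
    arc, a reversed arc, or a non-adjacent pair.  The difference of two
    realizations is then a circulation, supported on pairs (u, v) such that
    (v, u) is not an arc of A: the residual pairs.  The four forbidden digraphs
    are exactly the residual 3-cycles, and pushing one unit along such a cycle
    changes A into another realization.  If there is no residual 3-cycle, then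
    the out-neighbourhoods of A are nested along residual pairs and grow
    strictly along two consecutive ones; walking backwards along a nonzero
    circulation would make them grow forever. *)

Set Implicit Arguments.
Unset Strict Implicit.
Unset Printing Implicit Defensive.

Import Order.TTheory GRing.Theory Num.Theory.

Local Open Scope ring_scope.

(** * Arc values and residual pairs *)

Section NetDegree.

Variable V : finType.
Implicit Types (A B : {set V * V}) (u v w x y z : V).

Definition arc_value A u v : int := ((u, v) \in A)%:Z - ((v, u) \in A)%:Z.

Lemma net_degree_sum A v : net_degree A v = \sum_u arc_value A u v.
Proof.
have card_sum (P : pred V) : #|[set u | P u]|%:Z = \sum_u (P u)%:Z.
  rewrite -sum1dep_card big_mkcond (big_morph Posz PoszD (erefl _)).
  by apply: eq_bigr => u _; case: (P u).
by rewrite ffunE /arc_value sumrB !card_sum.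
Qed.

Lemma arc_valueC A u v : arc_value A u v = - arc_value A v u.
Proof. by rewrite /arc_value opprB. Qed.

Lemma simple_loop A u : simple_digraph A -> ((u, u) \in A) = false.
Proof. by case=> noloop _; apply/negbTE. Qed.

Lemma simple_rev A u v : simple_digraph A -> (u, v) \in A -> (v, u) \notin A.
Proof. by case=> _ /(_ u v) + uv; rewrite uv. Qed.

Lemma arc_value_inj A B : simple_digraph A -> simple_digraph B ->
  (forall u v, arc_value A u v = arc_value B u v) -> A = B.
Proof.
move=> [_ sA] [_ sB] eqAB; apply/setP=> -[u v].
move: (sA u v) (sB u v) (eqAB u v); rewrite /arc_value.
by do 4!case: (_ \in _).
Qed.

Definition residual A u v : bool := (u != v) && ((v, u) \notin A).

Definition residual_triangle A x y z : bool :=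
  [&& residual A x y, residual A y z & residual A z x].

Lemma arc_residual A u v : simple_digraph A -> (u, v) \in A -> residual A u v.
Proof.
move=> sA uv; rewrite /residual simple_rev // andbT.
by apply: contraTneq uv => ->; rewrite simple_loop.
Qed.

(** Values lie between -1 and 1, so a value that can be lowered is not -1, and [(v, u)] is not an
    arc. *)
Lemma arc_value_residual A B u v :
  simple_digraph A -> simple_digraph B ->
  arc_value B u v < arc_value A u v -> residual A u v.
Proof.
move=> sA sB ltBA; apply/andP; split.
  by apply: contraTneq ltBA => ->; rewrite /arc_value !subrr ltxx.
by move: (sA.2 u v) (sB.2 u v) ltBA; rewrite /arc_value; do 4!case: (_ \in _).
Qed.

(** Conservation at [u]: the values into [u] have the same sum for [A] and [B]. By antisymmetry the
    term at [v] is larger for [B], so another term is smaller. *)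
Lemma arc_value_lt_pred A B u v :
  net_degree B = net_degree A -> arc_value B u v < arc_value A u v ->
  exists t, arc_value B t u < arc_value A t u.
Proof.
move=> eqd; rewrite arc_valueC [ltRHS]arc_valueC ltrN2 => lt_uv.
apply/existsP; apply: contraT => /existsPn le_AB.
have := congr1 (fun d : {ffun V -> int} => d u) eqd.
rewrite !net_degree_sum => eq_sum.
suff: \sum_t arc_value A t u < \sum_t arc_value B t u by rewrite eq_sum ltxx.
rewrite (bigD1 v) //= [ltRHS](bigD1 v) //= ltr_leD // ler_sum // => t _.
by rewrite leNgt.
Qed.

(** * Uniqueness in the absence of residual triangles *)

Section NoResidualTriangle.

Variable A : {set V * V}.
Hypothesis sA : simple_digraph A.
Hypothesis noT : forall x y z, ~~ residual_triangle A x y z.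

Lemma residual_trans_arc u v w :
  residual A u v -> residual A v w -> u != w -> (u, w) \in A.
Proof.
move=> uv vw uw; have := noT u v w.
by rewrite /residual_triangle uv vw /residual eq_sym uw /= negbK.
Qed.

Definition out_nbhd v := [set w | (v, w) \in A].

(** An arc [(v, w)] is itself residual and [w] is not [u]; since [u], [v], [w] is not a residual
    triangle, [(u, w)] must be an arc. *)
Lemma residual_out_nbhd u v :
  residual A u v -> out_nbhd v \subset out_nbhd u.
Proof.
move=> uv; apply/subsetP=> w; rewrite !inE => vw.
apply: (residual_trans_arc uv (arc_residual sA vw)).
by apply: contraTneq vw => <-; case/andP: uv.
Qed.

Lemma no_residual_triangle_unique : net_degree_uniquely_realizable A.
Proof.
move=> B sB eqd.
have noincr u : forall v, ~ arc_value B u v < arc_value A u v.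
  have [n] := ubnP (#|V| - #|out_nbhd u|)%N.
  elim: n u => // n IHn u lt_n v lt_uv.
  (* One step back gives only an inclusion of out-neighbourhoods. Two steps make it strict: [u] is
     an out-neighbour of [s] but not of itself. *)
  have [t lt_tu] := arc_value_lt_pred eqd lt_uv.
  have [s lt_st] := arc_value_lt_pred eqd lt_tu.
  have r_tu := arc_value_residual sA sB lt_tu.
  have r_st := arc_value_residual sA sB lt_st.
  (* By antisymmetry the value at [(u, t)] is larger in [B], while the value at [(s, t)] is
     smaller. *)
  have su : s != u.
    apply: contraTneq lt_st => ->; rewrite -leNgt.
    by rewrite arc_valueC [leRHS]arc_valueC lerN2 ltW.
  apply: (IHn s _ _ lt_st).
  rewrite ltnS in lt_n; apply: leq_trans lt_n.
  suff /proper_card lt_us: out_nbhd u \proper out_nbhd s.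
    by apply: ltn_sub2l (lt_us); apply: leq_trans lt_us (max_card _).
  apply/properP; split.
    exact: subset_trans (residual_out_nbhd r_tu) (residual_out_nbhd r_st).
  exists u; rewrite inE ?simple_loop //.
  exact: residual_trans_arc r_st r_tu su.
apply: arc_value_inj => // u v; apply/eqP; rewrite eq_le.
have /negP := noincr u v; rewrite -leNgt => ->.
have /negP := noincr v u; rewrite -leNgt.
by rewrite arc_valueC [leRHS]arc_valueC lerN2 => ->.
Qed.

End NoResidualTriangle.

(** * Pushing one unit along a residual triangle *)

Definition cycle3 x y z : {set V * V} := [set (x, y); (y, z); (z, x)].

(** Along the cycle, an arc becomes a non-adjacent pair and a non-adjacent pair becomes a reversed
    arc; reversed arcs do not occur on a residual cycle. *)
Definition push_cycle A x y z : {set V * V} :=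
  [set a | (a \in A) && (a \notin cycle3 x y z)
           || ((a.2, a.1) \in cycle3 x y z) && ((a.2, a.1) \notin A)].

Section Push.

Variables (A : {set V * V}) (x y z : V).
Hypotheses (sA : simple_digraph A) (xyzT : residual_triangle A x y z).

Lemma cycle3_distinct : [/\ x != y, y != z & z != x].
Proof. by case/and3P: xyzT => /andP[-> _] /andP[-> _] /andP[-> _]. Qed.

Lemma cycle3_residual u v : (u, v) \in cycle3 x y z -> residual A u v.
Proof.
case/and3P: xyzT => xy yz zx; rewrite !inE !xpair_eqE.
by case/orP=> [/orP[]|] /andP[/eqP-> /eqP->].
Qed.

Lemma cycle3_rev u v :
  (u, v) \in cycle3 x y z -> (v, u) \notin cycle3 x y z.
Proof.
have [/negbTE xy /negbTE yz /negbTE zx] := cycle3_distinct.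
rewrite !inE !xpair_eqE.
by case/orP=> [/orP[]|] /andP[/eqP-> /eqP->];
  rewrite ?[y == x]eq_sym ?[z == y]eq_sym ?[x == z]eq_sym xy yz zx ?andbF.
Qed.

Lemma mem_push_cycle u v :
  ((u, v) \in push_cycle A x y z) =
    ((u, v) \in A) && ((u, v) \notin cycle3 x y z)
    || ((v, u) \in cycle3 x y z) && ((v, u) \notin A).
Proof. by rewrite inE. Qed.

Lemma cycle3_arcF u v : (u, v) \in cycle3 x y z -> (v, u) \notin A.
Proof. by case/cycle3_residual/andP. Qed.

Lemma push_cycle_simple : simple_digraph (push_cycle A x y z).
Proof.
split=> [u|u v]; rewrite !mem_push_cycle.
  rewrite simple_loop // andbT /=; apply/negP=> uu.
  by have := cycle3_rev uu; rewrite uu.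
(* As boolean implications, these facts reduce the goal to a truth table in the memberships of
   [(u, v)] and [(v, u)] in [A] and in the cycle. *)
move: (introT implyP (@cycle3_rev u v)) (introT implyP (@cycle3_arcF u v)).
move: (introT implyP (@cycle3_arcF v u)) (sA.2 u v).
by do 4!case: (_ \in _).
Qed.

Lemma arc_value_push_cycle u v :
  arc_value (push_cycle A x y z) u v =
    arc_value A u v - ((u, v) \in cycle3 x y z)%:Z
                    + ((v, u) \in cycle3 x y z)%:Z.
Proof.
rewrite /arc_value !mem_push_cycle.
move: (introT implyP (@cycle3_rev u v)) (introT implyP (@cycle3_arcF u v)).
move: (introT implyP (@cycle3_arcF v u)) (sA.2 u v).
by do 4!case: (_ \in _).
Qed.

Lemma cycle3_balanced v :
  \sum_u ((u, v) \in cycle3 x y z)%:Z = \sum_u ((v, u) \in cycle3 x y z)%:Z.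
Proof.
have [/negbTE xy /negbTE yz /negbTE zx] := cycle3_distinct.
have sum_eq w (b : bool) : \sum_u ((u == w) && b)%:Z = b%:Z.
  by rewrite (bigD1 w) //= eqxx big1 ?addr0 // => u /negbTE->.
(* The three pairs are distinct, so the indicator of the cycle is a sum of products; summing out
   either endpoint leaves the indicators of [x], [y] and [z] at [v]. *)
have memE a b : ((a, b) \in cycle3 x y z)%:Z =
    ((a == x) && (b == y))%:Z + ((a == y) && (b == z))%:Z
      + ((a == z) && (b == x))%:Z.
  rewrite !inE !xpair_eqE.
  have [->|_] := eqVneq a x; first rewrite xy [x == z]eq_sym zx.
    by case: (b == y).
  have [->|_] := eqVneq a y; first by rewrite yz /=; case: (b == z).
  by rewrite !add0r.
under eq_bigr do rewrite memE.
under [RHS]eq_bigr do rewrite memE ![(v == _) && _]andbC.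
by rewrite !big_split /= !sum_eq addrC addrA.
Qed.

Lemma push_cycle_net_degree : net_degree (push_cycle A x y z) = net_degree A.
Proof.
apply/ffunP=> v; rewrite !net_degree_sum.
under eq_bigr do rewrite arc_value_push_cycle.
by rewrite big_split sumrB /= cycle3_balanced subrK.
Qed.

Lemma residual_triangle_not_unique : ~ net_degree_uniquely_realizable A.
Proof.
move/(_ _ push_cycle_simple push_cycle_net_degree) => eqA.
have xyC : (x, y) \in cycle3 x y z by rewrite !inE eqxx.
(* The push lowers the value at [(x, y)] by one, so it cannot return [A]. *)
have := arc_value_push_cycle x y.
by rewrite eqA xyC (negbTE (cycle3_rev xyC)); lia.
Qed.

End Push.
End NetDegree.

(** * Residual triangles and the four forbidden digraphs *)

Lemma contains_inducedP (V W : finType) (A : {set V * V}) (H : {set W * W}) :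
  contains_induced A H <->
  exists2 h : W -> V, injective h &
    forall i j, ((h i, h j) \in A) = ((i, j) \in H).
Proof.
split=> [[S [f [[g fK gK] fH]]] | [h injh hH]].
  exists (val \o g); first exact: inj_comp val_inj (can_inj gK).
  by move=> i j; rewrite -[in RHS](gK i) -[in RHS](gK j) -fH inE.
pose S := [set h i | i in W].
pose g i : {v | v \in S} := exist _ (h i) (imset_f h isT).
have injg : injective g by move=> i j /(congr1 val) /injh.
(* The isomorphism runs from the image of [h] back to [W], so it is the inverse of [g], obtained by
   counting. *)
have [|f gK fK] := inj_card_bij injg.
  by rewrite card_sig (card_imset _ injh).
exists S, f; split=> [|a b]; first by exists g.
by rewrite -hH inE -[in LHS](fK a) -[in LHS](fK b).
Qed.

Lemma ord3_cases (P : 'I_3 -> Prop) :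
  P node_u -> P node_v -> P node_w -> forall i, P i.
Proof.
by move=> Pu Pv Pw [[|[|[|//]]] lt_i3]; [move: Pu | move: Pv | move: Pw];
  congr (P _); apply: val_inj.
Qed.

(** The default [x] of [nth] is never reached, and distinctness of the list makes [h] injective. *)
Lemma contains_induced3 (V : finType) (A : {set V * V}) (H : {set 'I_3 * 'I_3})
    (x y z : V) (h := fun i : 'I_3 => nth x [:: x; y; z] i) :
  uniq [:: x; y; z] -> (forall i j, ((h i, h j) \in A) = ((i, j) \in H)) ->
  contains_induced A H.
Proof.
move=> xyz_uniq hH; apply/contains_inducedP; exists h => // i j eq_ij.
by apply/val_inj/eqP; rewrite -(nth_uniq x _ _ xyz_uniq) ?ltn_ord //; apply/eqP.
Qed.

(** Residual pairs are defined by node equality and arc membership alone, and an embedding preserves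
    and reflects both. *)
Lemma contains_induced_residual_triangle (V W : finType)
    (A : {set V * V}) (H : {set W * W}) (i j k : W) :
  residual_triangle H i j k -> contains_induced A H ->
  exists x y z, residual_triangle A x y z.
Proof.
move=> ijk /contains_inducedP[h injh hH]; exists (h i), (h j), (h k).
by rewrite /residual_triangle /residual !(inj_eq injh) !hH.
Qed.

(** Each pair of the triangle is an arc or non-adjacent; zero, one, two or three arcs give [empty3],
    [single_arc3], [directed_path3] and [directed_triangle]. *)
Lemma residual_triangle_contains_induced (V : finType) (A : {set V * V}) x y z :
  simple_digraph A -> residual_triangle A x y z ->
  [\/ contains_induced A empty3, contains_induced A single_arc3,
      contains_induced A directed_triangle | contains_induced A directed_path3].
Proof.
move=> sA xyzT; case/and3P: (xyzT) => /andP[/negbTE xy /negbTE Ayx].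
move=> /andP[/negbTE yz /negbTE Azy] /andP[/negbTE zx /negbTE Axz].
have distE := (xy, yz, zx, etrans (eq_sym _ _) xy, etrans (eq_sym _ _) yz,
               etrans (eq_sym _ _) zx).
have loopE u := simple_loop u sA.
(* The node order matches the pattern: a path starts at the tail of its first arc, and a single arc
   joins the first and last nodes listed. *)
have [Axy|/negbTE Axy] := boolP ((x, y) \in A);
  have [Ayz|/negbTE Ayz] := boolP ((y, z) \in A);
  have [Azx|/negbTE Azx] := boolP ((z, x) \in A);
  [apply: Or43; apply: (@contains_induced3 _ _ _ x y z)
  |apply: Or44; apply: (@contains_induced3 _ _ _ x y z)
  |apply: Or44; apply: (@contains_induced3 _ _ _ z x y)
  |apply: Or42; apply: (@contains_induced3 _ _ _ x z y)
  |apply: Or44; apply: (@contains_induced3 _ _ _ y z x)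
  |apply: Or42; apply: (@contains_induced3 _ _ _ y x z)
  |apply: Or42; apply: (@contains_induced3 _ _ _ z y x)
  |apply: Or41; apply: (@contains_induced3 _ _ _ x y z)];
  rewrite /= ?inE ?distE //;
  apply: ord3_cases; apply: ord3_cases;
  by rewrite /= ?loopE ?Axy ?Ayz ?Azx ?Ayx ?Azy ?Axz !inE.
Qed.

Theorem corollary3p5 (V : finType) (A : {set V * V}) (hA : simple_digraph A) :
  net_degree_uniquely_realizable A <->
  ~ contains_induced A empty3 /\
  ~ contains_induced A single_arc3 /\
  ~ contains_induced A directed_triangle /\
  ~ contains_induced A directed_path3.
Proof.
split=> [uniqA | [no1 [no2 [no3 no4]]]].
  have noC (H : {set 'I_3 * 'I_3}) i j k :
      residual_triangle H i j k -> ~ contains_induced A H.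
    move=> ijk /(contains_induced_residual_triangle ijk)[x [y [z xyzT]]].
    exact: residual_triangle_not_unique hA xyzT uniqA.
  (* A residual triangle must follow the arcs of the pattern; the single arc from [node_u] to
     [node_w] therefore forces the other cyclic order. *)
  by split; [apply: (noC _ node_u node_v node_w) | split;
    [apply: (noC _ node_u node_w node_v) | split;
      apply: (noC _ node_u node_v node_w)]];
    rewrite /residual_triangle /residual !inE.
apply: no_residual_triangle_unique => // x y z; apply/negP=> xyzT.
by case: (residual_triangle_contains_induced hA xyzT).
Qed.
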